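(* Let $I\subseteq\mathbb{F}_q[X_1,\dots,X_m]$ be an ideal and $\prec_w$ a generalized weighted degree ordering such that $(I,\prec_w)$ satisfies the order domain conditions. Let $\mathcal{P}=\{P_1,\dots,P_h\}\subseteq\mathcal{V}_{\overline{\mathbb{F}}_q}(I)$ with $\deg(P_i)=r_i$ for $i=1,\dots,h$, let $J\subseteq\mathbb{F}_q[X_1,\dots,X_m]$ be an ideal such that $\mathcal{P}=\mathcal{V}_{\overline{\mathbb{F}}_q}(I+J)$, and put $I_{\mathcal{P}}=I+J$. Let $L$ be a vector space over $\mathbb{F}_q$ with well-behaving basis $\{b_1+I_{\mathcal{P}},\dots,b_k+I_{\mathcal{P}}\}$. For $i=1,\dots,h$ let $\pi_i:\mathbb{F}_{q^{r_i}}\to C_i$ be an $\mathbb{F}_q$-linear isomorphism onto a linear code $C_i$ over $\mathbb{F}_q$ with parameters $[n_i,r_i,d_i]$, and put $\mathcal{C}=\{C_1,\dots,C_h\}$. Let $\Delta=\Delta_{\prec_w}(I_{\mathcal{P}})$. Then the extended affine-variety code $C(I,L,\mathcal{P},\mathcal{C})$ has minimum distance at least $\delta\,\hat d$, where $$\delta=\min\{\sigma_\Delta(w(\alpha))\mid \alpha\in\square_{\prec_w}(L)\},\qquad \hat d=\min\{d_1,\dots,d_h\}.$$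
   Context: Notation. $\overline{\mathbb{F}}_q$ is the algebraic closure of $\mathbb{F}_q$. For an ideal $K\subseteq\mathbb{F}_q[X_1,\dots,X_m]$, $\mathcal{V}_{\overline{\mathbb{F}}_q}(K)\subseteq\overline{\mathbb{F}}_q^{\,m}$ is the set of common zeros of $K$. The degree $\deg(P)$ of a point $P$ is the least positive integer $l$ such that $P$ is $\mathbb{F}_{q^l}$-rational. $\mathcal{M}$ is the set of monomials in $X_1,\dots,X_m$; $\mathrm{lm}(f)$ is the leading monomial of $f$ and $\mathrm{Supp}(f)$ the set of monomials occurring in $f$ with nonzero coefficient. Generalized weighted degree ordering (standard definition): fix nonzero weights $w(X_1),\dots,w(X_m)\in\mathbb{N}_0^t$ and extend to $w:\mathcal{M}\to\mathbb{N}_0^t$ by $w(X_1^{a_1}\cdots X_m^{a_m})=\sum_i a_i w(X_i)$; fix a monomial ordering $\prec_{\mathbb{N}_0^t}$ on $\mathbb{N}_0^t$ and a monomial ordering $\prec_{\mathcal{M}}$ on $\mathcal{M}$. Then $M_1\prec_w M_2$ if and only if $w(M_1)\prec_{\mathbb{N}_0^t}w(M_2)$, or $w(M_1)=w(M_2)$ and $M_1\prec_{\mathcal{M}}M_2$. Footprint: for an ideal $K$ of $\mathbb{F}_q[X_1,\dots,X_m]$, $\Delta_{\prec_w}(K)$ is the set of monomials that are not the leading monomial of any polynomial in $K$. Order domain conditions: $(I,\prec_w)$ satisfies them if $I$ possesses a Gröbner basis $\mathcal{G}$ (with respect to $\prec_w$) such that (i) any $g\in\mathcal{G}$ has exactly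 two monomials of highest weight in its support, and (ii) no two monomials in $\Delta_{\prec_w}(I)$ are of the same weight. Well-behaving basis: for a $k$-dimensional subspace $L$ of $\mathbb{F}_q[X_1,\dots,X_m]/I_{\mathcal{P}}$, a basis $\{b_1+I_{\mathcal{P}},\dots,b_k+I_{\mathcal{P}}\}$ with $\mathrm{Supp}(b_i)\subseteq\Delta_{\prec_w}(I_{\mathcal{P}})$ for all $i$ and $\mathrm{lm}(b_1)\prec_w\dots\prec_w\mathrm{lm}(b_k)$. Set $\square_{\prec_w}(L)=\{\mathrm{lm}(b_1),\dots,\mathrm{lm}(b_k)\}$, which is the same for all well-behaving bases of $L$. The function $\sigma_\Delta$: let $\Gamma=w(\Delta_{\prec_w}(I))\subseteq\mathbb{N}_0^t$. For $\lambda\in w(\Delta)$, $\sigma_\Delta(\lambda)=|\{\eta\in w(\Delta)\mid \eta-\lambda\in\Gamma\}|$. Extended affine-variety code: with $n=\sum_{i=1}^h n_i$, $C(I,L,\mathcal{P},\mathcal{C})$ is the image of the $\mathbb{F}_q$-linear map $\overline{ev}:L\to\mathbb{F}_q^n$, $f\mapsto(\pi_1(f(P_1)),\dots,\pi_h(f(P_h)))$. An $[n_i,r_i,d_i]$ code is a linear code of length $n_i$, dimension $r_i$ and minimum distance $d_i$.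
   Formalization: The ideal I_P = I+J is additionally assumed to be radical; without this the bound fails, e.g. for I = 0, J = (X^2), P = {0}, L spanned by 1 and C_1 = F_q, where δ·d̂ = 2 but the minimum distance is 1. *)

(* Defs.v *)
From HB Require Import structures.
From mathcomp Require Import all_boot all_order all_algebra all_field.
From mathcomp Require Import finmap mpoly.
From mathcomp Require Import boolp classical_sets functions cardinality.

Set Implicit Arguments.
Unset Strict Implicit.
Unset Printing Implicit Defensive.

Import GRing.Theory.

Local Open Scope classical_set_scope.
Local Open Scope ring_scope.

(* The minimum of a nonempty set of natural numbers; the value is 0 on the
   empty set. *)
Definition natmin (A : set nat) : nat :=
  xget 0%N [set n | A n /\ forall k, A k -> (n <= k)%N].

(* ** Monomials, weights and orderings.
   'X_{1..n} is used both for monomials (exponent vectors) and, through its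
   additive monoid structure, for the monoid N_0^n in which weights live. *)

Definition monomial_order (n : nat) (lt : rel 'X_{1..n}) : Prop :=
  [/\ irreflexive lt,
      transitive lt,
      forall a b, a != b -> lt a b || lt b a,
      forall a b c, lt a b -> lt (a + c)%MM (b + c)%MM
    & well_founded (fun a b => lt a b)].

Definition weight (m t : nat) (w : 'I_m -> 'X_{1..t}) (M : 'X_{1..m}) :
    'X_{1..t} :=
  (\sum_(i < m) (w i *+ M i))%MM.

Definition gwd_order (m t : nat) (w : 'I_m -> 'X_{1..t})
    (ltN : rel 'X_{1..t}) (ltM : rel 'X_{1..m}) : rel 'X_{1..m} :=
  fun M1 M2 => ltN (weight w M1) (weight w M2)
               || (weight w M1 == weight w M2) && ltM M1 M2.

(* 0%MM (the monomial 1) is the least element of any monomial ordering, so it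
   is a neutral starting value; [lm lt 0] is 0%MM and carries no meaning. *)
Definition lm (R : nzRingType) (m : nat) (lt : rel 'X_{1..m})
    (f : {mpoly R[m]}) : 'X_{1..m} :=
  \big[(fun M N => if lt M N then N else M) / 0%MM]_(M <- msupp f) M.

(* ** Ideals *)

Definition is_ideal (R : comNzRingType) (m : nat) (K : set {mpoly R[m]}) : Prop :=
  [/\ K 0,
      forall f g, K f -> K g -> K (f + g)
    & forall f g, K g -> K (f * g)].

Definition ideal_add (R : comNzRingType) (m : nat) (K K' : set {mpoly R[m]}) :
    set {mpoly R[m]} :=
  [set f | exists g g', [/\ K g, K' g' & f = g + g']].

(* For K = I + J with zero set P, being radical means that K is the vanishing
   ideal of P, so that evaluation at P is injective modulo K.  Without it the
   bound fails: in F[X], take I = 0, J = (X^2), P = {0} and L spanned by 1. *)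
Definition is_radical (R : comNzRingType) (m : nat) (K : set {mpoly R[m]}) : Prop :=
  forall (f : {mpoly R[m]}) (e : nat), K (f ^+ e) -> K f.

Definition footprint (R : comNzRingType) (m : nat) (lt : rel 'X_{1..m})
    (K : set {mpoly R[m]}) : set 'X_{1..m} :=
  [set M | ~ exists f, [/\ K f, f != 0 & lm lt f = M]].

(* [(a <= b)%MM] is divisibility of monomials. *)
Definition groebner_basis (R : comNzRingType) (m : nat) (lt : rel 'X_{1..m})
    (K : set {mpoly R[m]}) (G : seq {mpoly R[m]}) : Prop :=
  (forall g, g \in G -> K g /\ g != 0) /\
  (forall f, K f -> f != 0 -> exists2 g, g \in G & (lm lt g <= lm lt f)%MM).

Definition highest_weight_monomials (R : comNzRingType) (m t : nat)
    (w : 'I_m -> 'X_{1..t}) (ltN : rel 'X_{1..t}) (g : {mpoly R[m]}) :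
    seq 'X_{1..m} :=
  [seq M <- msupp g | all (fun N => ~~ ltN (weight w M) (weight w N)) (msupp g)].

Definition order_domain_conditions (R : comNzRingType) (m t : nat)
    (w : 'I_m -> 'X_{1..t}) (ltN : rel 'X_{1..t}) (ltM : rel 'X_{1..m})
    (I : set {mpoly R[m]}) : Prop :=
  let ltw := gwd_order w ltN ltM in
  (exists2 G, groebner_basis ltw I G &
     forall g, g \in G -> size (highest_weight_monomials w ltN g) = 2%N) /\
  (forall M N, footprint ltw I M -> footprint ltw I N ->
     weight w M = weight w N -> M = N).

(* [eta - lambda \in Gamma] is a condition in Z^t, hence the existential
   rather than truncated subtraction.  [fset_set] is only meaningful on finite
   sets; sigma is used with [IP] having finitely many zeros, in which case
   [w (Delta (IP))] is finite. *)
Definition sigma (R : comNzRingType) (m t : nat)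
    (w : 'I_m -> 'X_{1..t}) (ltw : rel 'X_{1..m})
    (I IP : set {mpoly R[m]}) (lambda : 'X_{1..t}) : nat :=
  let Gamma := weight w @` footprint ltw I in
  let wDelta := weight w @` footprint ltw IP in
  #|` fset_set [set eta | wDelta eta /\
                  exists2 gamma, Gamma gamma & eta = (lambda + gamma)%MM] |%fset.

(* A subspace L of the quotient ring by IP is represented by its preimage in the
   polynomial ring, i.e. by the union of the cosets belonging to it. *)
Definition well_behaving_basis (R : fieldType) (m : nat) (ltw : rel 'X_{1..m})
    (IP L : set {mpoly R[m]}) (k : nat) (b : 'I_k -> {mpoly R[m]}) : Prop :=
  [/\ forall c : 'I_k -> R, IP (\sum_(i < k) c i *: b i) -> forall i, c i = 0,
      forall f, L f <-> exists c : 'I_k -> R, IP (f - \sum_(i < k) c i *: b i),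
      forall i M, M \in msupp (b i) -> footprint ltw IP M
    & forall i j : 'I_k, (i < j)%N -> ltw (lm ltw (b i)) (lm ltw (b j))].

Definition square (R : fieldType) (m : nat) (ltw : rel 'X_{1..m}) (k : nat)
    (b : 'I_k -> {mpoly R[m]}) : set 'X_{1..m} :=
  range (fun i => lm ltw (b i)).

(* ** Points over an extension [iota : F -> E], meant to be the algebraic
   closure of the finite field F *)

Definition evalpt (F E : fieldType) (iota : {rmorphism F -> E}) (m : nat)
    (P : m.-tuple E) (f : {mpoly F[m]}) : E :=
  mmap iota (tnth P) f.

Definition variety (F E : fieldType) (iota : {rmorphism F -> E}) (m : nat)
    (K : set {mpoly F[m]}) : set (m.-tuple E) :=
  [set P | forall f, K f -> evalpt iota P f = 0].

(* The subfield with [#|F| ^ l] elements of an algebraic closure E of F. *)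
Definition finsubfield (F : finFieldType) (E : fieldType) (l : nat) : set E :=
  [set x | x ^+ (#|F| ^ l) = x].

Definition pt_degree (F : finFieldType) (E : fieldType) (m : nat)
    (P : m.-tuple E) : nat :=
  natmin [set l | (0 < l)%N /\ forall j, finsubfield F l (tnth P j)].

(* ** Codes *)

Definition hdist (T : eqType) (n : nat) (u v : 'rV[T]_n) : nat :=
  #|[pred j | u ord0 j != v ord0 j]|.

Definition mindist (T : eqType) (n : nat) (C : set 'rV[T]_n) : nat :=
  natmin [set d | exists u v, [/\ C u, C v, u != v & d = hdist u v]].

Definition linear_code_params (F : finFieldType) (n : nat)
    (C : {vspace 'rV[F]_n}) (r d : nat) : Prop :=
  \dim C = r /\ mindist [set u | u \in C] = d.

(* [pi] is an F-linear isomorphism from the subfield with [#|F| ^ r] elements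
   onto C; its values outside this subfield are irrelevant. *)
Definition linear_iso_onto (F : finFieldType) (E : fieldType)
    (iota : {rmorphism F -> E}) (r n : nat) (C : {vspace 'rV[F]_n})
    (pi : E -> 'rV[F]_n) : Prop :=
  (forall (a : F) (x y : E), finsubfield F r x -> finsubfield F r y ->
     pi (iota a * x + y) = a *: pi x + pi y) /\
  set_bij (@finsubfield F E r) [set u | u \in C] pi.

Definition ext_ev (F : finFieldType) (E : fieldType)
    (iota : {rmorphism F -> E}) (m h : nat) (P : 'I_h -> m.-tuple E)
    (n : 'I_h -> nat) (pi : forall i, E -> 'rV[F]_(n i))
    (f : {mpoly F[m]}) : 'rV[F]_(\sum_i n i) :=
  \mxrow_i pi i (evalpt iota (P i) f).

(* When the ideal defining the quotient vanishes at all the points, [ext_ev]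
   is constant on its cosets. *)
Definition ext_affine_variety_code (F : finFieldType) (E : fieldType)
    (iota : {rmorphism F -> E}) (m h : nat) (P : 'I_h -> m.-tuple E)
    (n : 'I_h -> nat) (pi : forall i, E -> 'rV[F]_(n i))
    (L : set {mpoly F[m]}) : set 'rV[F]_(\sum_i n i) :=
  ext_ev iota P pi @` L.

(* Main.v *)
Require Import Defs.
From HB Require Import structures.
From mathcomp Require Import all_boot all_order all_algebra all_field.
From mathcomp Require Import finmap mpoly.
From mathcomp Require Import boolp classical_sets functions cardinality.
From mathcomp Require Import ring.

(* Two distinct codewords differ by the encoding of some [f] in [L] whose leading
   monomial [alpha] lies in the square of [L].  If [eta = w(alpha) + w(M)] is counted
   by sigma, the order domain conditions give
   [f * M = c * delta + (terms of lower weight)] modulo [I], with [c != 0] and [delta] the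
   monomial of weight [eta] in the footprint of [IP].  Hence these products [f * M] are
   linearly independent over F modulo [IP].  By the Nullstellensatz they stay independent
   over F when evaluated at the points, and since Frobenius permutes the points, also
   over the algebraic closure (Galois descent).  All the evaluation vectors vanish wherever
   [f] does, so [f] has at least sigma nonzero values; each of them contributes at least
   [dhat] to the Hamming distance. *)

Set Implicit Arguments.
Unset Strict Implicit.
Unset Printing Implicit Defensive.

Import GRing.Theory.

Local Open Scope classical_set_scope.
Local Open Scope ring_scope.

(** * The Nullstellensatz *)

(** Properness is not built in: where it matters, an element outside [p] is supplied separately. *)
Definition prime_ideal (R : comNzRingType) (p : set R) : Prop :=
  [/\ p 0,
      forall x y, p x -> p y -> p (x + y),
      forall x y, p y -> p (x * y)
    & forall x y, p (x * y) -> p x \/ p y].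

Lemma prime_idealX (R : comNzRingType) (p : set R) (x : R) (e : nat) :
  prime_ideal p -> ~ p x -> ~ p 1 -> ~ p (x ^+ e).
Proof.
case=> _ _ _ pP px p1; elim: e => [|e IH]; first by rewrite expr0.
by rewrite exprS => /pP [].
Qed.

Lemma prime_ideal_preim (R S : comNzRingType) (f : {rmorphism R -> S})
  (p : set S) : prime_ideal p -> prime_ideal (f @^-1` p).
Proof.
case=> p0 pD pM pP; split => [|x y px py|x y py|x y].
- by rewrite /preimage/= rmorph0.
- by rewrite /preimage/= rmorphD; apply: pD.
- by rewrite /preimage/= rmorphM; apply: pM.
- by rewrite /preimage/= rmorphM; apply: pP.
Qed.

Lemma classical_minn (A : set nat) :
  A !=set0 -> exists n, A n /\ forall k, A k -> (n <= k)%N.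
Proof.
case=> n0 An0; have ex : exists n, `[< A n >] by exists n0; apply/asboolP.
case: (ex_minnP ex) => n /asboolP An min_n; exists n; split => // k Ak.
by apply: min_n; apply/asboolP.
Qed.

Lemma min_size_poly (R : nzRingType) (A : set {poly R}) : A !=set0 ->
  exists g, A g /\ forall u, A u -> (size g <= size u)%N.
Proof.
case=> g0 Ag0; have [|n [[g Ag <-] min_n]] := @classical_minn [set (size g : nat) | g in A].
  by exists (size g0); exists g0.
by exists g; split => // u Au; apply: min_n; exists u.
Qed.

Lemma size_sub_lead (R : nzRingType) (g : {poly R}) : g != 0 ->
  (size (g - lead_coef g *: 'X^((size g).-1))%R < size g)%N.
Proof.
move=> g0; have sg : (0 < size g)%N by rewrite size_poly_gt0.
rewrite -{2}(prednK sg) ltnS; apply/leq_sizeP => j.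
rewrite leq_eqVlt => /orP[/eqP <-|lj].
  by rewrite coefB coefZ coefXn eqxx mulr1 subrr.
rewrite coefB coefZ coefXn gtn_eqF // mulr0 subr0; apply: nth_default.
by rewrite -(prednK sg).
Qed.

(* Abstract form of the Nullstellensatz; [j] records the coefficient field. *)
Definition has_zeros (F : Type) (E : closedFieldType) (iota : F -> E)
    (R : comNzRingType) (j : F -> R) : Prop :=
  forall (p : set R) (a : R), prime_ideal p -> ~ p a ->
  exists phi : {rmorphism R -> E},
    [/\ forall c, phi (j c) = iota c, forall x, p x -> phi x = 0 & phi a != 0].

(** Let [p'] be the contraction of [p] to [R]. Either all members of [p] have coefficients in [p'],
    and any non-root of the image of [f] serves, or [X] is algebraic modulo [p], and a root of a
    minimal relation [g] serves. Pseudo-division replaces division over the fraction field of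
    [R / p']. *)
Lemma has_zeros_poly (F : Type) (E : closedFieldType) (iota : F -> E)
    (R : idomainType) (j : F -> R) :
  has_zeros iota j -> has_zeros iota (fun c => (j c)%:P : {poly R}).
Proof.
move=> hR p f pP pf; have [p0 pD pM pI] := pP.
have pB x y : p x -> p y -> p (x - y).
  by move=> px py; apply: pD => //; rewrite -mulN1r; apply: pM.
have p1 : ~ p 1 by move=> /(pM f); rewrite mulr1.
have pZ (x : R) y : p y -> p (x *: y) by rewrite -mul_polyC; apply: pM.
pose p' : set R := polyC @^-1` p.
have p'P : prime_ideal p' := prime_ideal_preim (@polyC R) pP.
have [p'0 p'D p'M p'I] := p'P.
have p'1 : ~ p' 1 by [].
have p'Z (x : {poly R}) y : p' y -> p (y *: x) by rewrite -mul_polyC mulrC; apply: pM.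
have coef_p (q : {poly R}) : (forall i, p' q`_i) -> p q.
  move=> hq; rewrite -[q]coefK poly_def; elim/big_rec: _ => // i x _ px.
  by apply: pD => //; apply: p'Z.
pose ev (phi : {rmorphism R -> E}) xi : {rmorphism {poly R} -> E} :=
  horner_eval xi \o map_poly phi.
have evE phi xi u : ev phi xi u = (map_poly phi u).[xi] by [].
have evC (phi : {rmorphism R -> E}) xi c : ev phi xi c%:P = phi c.
  by rewrite evE map_polyC hornerC.
have map0 (phi : {rmorphism R -> E}) (q : {poly R}) : (forall x, p' x -> phi x = 0) ->
    (forall i, p' q`_i) -> map_poly phi q = 0.
  move=> phi0 hq; apply/polyP => i; rewrite coef_map coef0 /=; exact: phi0.
have [all_coef|] := pselect (forall u, p u -> forall i, p' u`_i).
  have /existsNP [i fi] : ~ forall i, p' f`_i by move=> /coef_p.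
  have [phi [phij phi0 phia]] := hR p' _ p'P fi.
  have : map_poly phi f != 0.
    by apply: contraNneq phia => /polyP/(_ i); rewrite coef_map coef0 => ->.
  move=> /closed_nonrootP [xi rxi]; exists (ev phi xi); split.
  - by move=> c; rewrite evC.
  - by move=> x /all_coef /(map0 _ _ phi0); rewrite evE => ->; rewrite horner0.
  - by [].
move=> /existsNP [g0 /not_implyP [pg0 /existsNP [i0 g0i0]]].
(* [g] acts as the minimal polynomial of [X] over the fraction field of [R / p']. *)
have [|g [[pg gbad] gmin]] := @min_size_poly R [set u | p u /\ ~ forall i, p' u`_i].
  by exists g0; split => // /(_ i0).
have {}gmin u : p u -> (size u < size g)%N -> forall i, p' u`_i.
  move=> pu; rewrite ltnNge => /negP su; apply: contrapT => ubad.
  by apply: su; apply: gmin.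
have g_neq0 : g != 0.
  by apply/eqP => g_eq0; apply: gbad => i; rewrite g_eq0 coef0.
have drop_lead (u : {poly R}) : p' (lead_coef u) -> p (lead_coef u *: 'X^((size u).-1)).
  exact: p'Z.
have lg : ~ p' (lead_coef g).
  move=> hlg; apply: gbad => i.
  have /gmin/(_ (size_sub_lead g_neq0) i) h := pB _ _ pg (drop_lead _ hlg).
  rewrite -[g](subrK (lead_coef g *: 'X^((size g).-1))) coefD.
  by apply: p'D => //; rewrite coefZ mulrC; apply: p'M.
(* The ideal generated by [f] and [p], minus [p]. Its shortest element [c] turns out to be a
   constant, so that [c = u * f + v] is a Bezout identity modulo [p]. *)
pose T := [set c | ~ p c /\ exists u v, p v /\ c = u * f + v].
have [|c [[pc [u [v [pv cE]]]] cmin]] := @min_size_poly R T.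
  by exists f; split => //; exists 1, 0; rewrite mul1r addr0.
have Tlin x y z : p z -> ~ p (x * c + y * z) -> T (x * c + y * z).
  move=> pz pN; split=> //; exists (x * u), (x * v + y * z); split.
    by apply: pD; apply: pM.
  by rewrite cE mulrDr mulrA addrA.
have {}cmin x y z : p z -> (size (x * c + y * z)%R < size c)%N -> p (x * c + y * z).
  move=> pz; rewrite ltnNge => /negP sz; apply: contrapT => /(Tlin _ _ _ pz) Tz.
  by apply: sz; apply: cmin.
have c_neq0 : c != 0 by apply/eqP => c0; apply: pc; rewrite c0.
have lc : ~ p' (lead_coef c).
  move=> hlc; apply: pc.
  have := @cmin 1 (- 1) _ (drop_lead _ hlc).
  rewrite mul1r mulN1r => /(_ (size_sub_lead c_neq0)) h.
  by rewrite -[c](subrK (lead_coef c *: 'X^((size c).-1))); apply: pD => //; apply: drop_lead.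
have sc_lt : (size c < size g)%N.
  rewrite ltnNge; apply/negP => sgc.
  have := Pdiv.Idomain.divp_eq c g.
  set s := Pdiv.Idomain.scalp _ _ => /eqP; rewrite addrC -subr_eq => /eqP E1.
  have : p (lead_coef g ^+ s *: c).
    have -> : lead_coef g ^+ s *: c =
        ((lead_coef g ^+ s)%:P * c + (- (c %/ g)) * g) + (c %/ g) * g.
      by rewrite mulNr subrK mul_polyC.
    apply: pD; last exact: pM.
    apply: cmin => //; rewrite mulNr mul_polyC E1.
    by apply: leq_trans sgc; rewrite ltn_modp.
  rewrite -mul_polyC => /pI [] //; exact: (prime_idealX p'P lg p'1).
(* Otherwise pseudo-dividing [g] by [c] leaves [r] in [p], so the quotient [q] lies in [p] and is
   shorter than [g]. Its coefficients are then in [p'], whereas [q * c] has in degree [(size g).-1]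
   a power of [lead_coef c] times [lead_coef g]. *)
have sc1 : size c = 1%N.
  apply/eqP; rewrite eqn_leq size_poly_gt0 c_neq0 andbT leqNgt; apply/negP => sc2.
  have := Pdiv.Idomain.divp_eq g c.
  set s := Pdiv.Idomain.scalp _ _; set q := g %/ c; set r := g %% c => E1.
  have sr : (size r < size c)%N by rewrite ltn_modp.
  have pr : p r.
    have Er : r = (- q) * c + (lead_coef c ^+ s)%:P * g.
      by rewrite mul_polyC E1 mulNr addrA addNr add0r.
    by rewrite Er; apply: cmin => //; rewrite -Er.
  have pq : p q.
    have : p (q * c) by rewrite -[q * c](addrK r) -E1; apply: pB => //; exact: pZ.
    by move=> /pI [].
  have lcs : lead_coef c ^+ s != 0 by rewrite expf_neq0 // lead_coef_eq0.
  have sq : (size q < size g)%N.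
    have [->|q0] := eqVneq q 0; first by rewrite size_poly0 size_poly_gt0.
    have : (size (q * c)%R <= size g)%N.
      rewrite -[q * c](addrK r) -E1; apply: leq_trans (size_polyD _ _) _.
      by rewrite size_polyN size_scale // geq_max leqnn ltnW // (ltn_trans sr).
    rewrite size_mul // => h; apply: leq_trans h.
    by rewrite -subn1 ltn_subRL addnC ltn_add2l.
  have cq := gmin _ pq sq.
  have : p' ((q * c)`_(size g).-1).
    rewrite coefM; elim/big_rec: _ => // i x _ px; apply: p'D => //.
    by rewrite mulrC; apply: p'M.
  rewrite -[q * c](addrK r) -E1 coefB [r`_ _]nth_default; last first.
    by rewrite -ltnS prednK ?size_poly_gt0 //; apply: ltn_trans sc_lt.
  rewrite subr0 coefZ => /p'I [|] //; exact: (prime_idealX p'P lc p'1).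
have [c0 cC] : exists c0, c = c0%:P by exists c`_0; apply: size1_polyC; rewrite sc1.
(* A nonzero image of [lead_coef g] preserves the degree of [g] and so yields a root [xi]; a nonzero
   image of [c0] keeps [f] from vanishing there, by the Bezout identity. *)
have [|phi [phij phi0]] := hR p' (lead_coef g * c0) p'P.
  by move=> /p'I [] //; rewrite /p' /preimage /= -cC.
rewrite rmorphM mulf_eq0 negb_or => /andP [phig phic].
have : size (map_poly phi g) != 1%N.
  rewrite size_poly_eq //; apply: contra_notN lg => /eqP sg.
  have gC : g = (g`_0)%:P by apply: size1_polyC; rewrite sg.
  by rewrite /p' /preimage /= gC lead_coefC -gC.
move=> /closed_rootP [xi /rootP rxi].
have ev0 x : p x -> ev phi xi x = 0.
  move=> px; have := Pdiv.Idomain.divp_eq x g.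
  set s := Pdiv.Idomain.scalp _ _; set q := x %/ g; set r := x %% g => E1.
  have pr : p r.
    have -> : r = lead_coef g ^+ s *: x - q * g by rewrite E1 addrC addKr.
    by apply: pB; [apply: pZ | apply: pM].
  have sr : (size r < size g)%N by rewrite ltn_modp.
  have r0 : ev phi xi r = 0 by rewrite evE (map0 _ _ phi0) ?horner0 //; apply: gmin.
  have : phi (lead_coef g ^+ s) * ev phi xi x = ev phi xi q * ev phi xi g + ev phi xi r.
    by rewrite -(evC phi xi) -!rmorphM -rmorphD mul_polyC E1.
  rewrite r0 addr0 [ev phi xi g]rxi mulr0 => /eqP.
  by rewrite mulf_eq0 rmorphXn expf_eq0 (negbTE phig) andbF => /eqP.
exists (ev phi xi); split => //; first by move=> a; rewrite evC.
apply: contraNneq phic => f0; have := evC phi xi c0; rewrite -cC cE rmorphD rmorphM f0.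
by rewrite (ev0 _ pv) mulr0 addr0 => <-.
Qed.

(** Induction on the number of variables, the last one being adjoined as a polynomial variable.
    Without variables, a nonzero member of [p] would be a unit. *)
Lemma has_zeros_mpoly (F : fieldType) (E : closedFieldType)
    (iota : {rmorphism F -> E}) (n : nat) :
  has_zeros iota (@mpolyC n F).
Proof.
elim: n => [|n IH] p f pP pf.
  have [p0 pD pM pI] := pP.
  exists (mmap iota (fun=> 0)); split => [c|x px|]; first exact: mmapC.
    rewrite /= [x]nvar0_mpolyC mmapC; have [->|x0] := eqVneq x@_0%MM 0.
      exact: rmorph0.
    case: pf; rewrite -[f]mulr1.
    suff -> : 1 = (x@_0%MM)^-1%:MP * x by rewrite mulrA; apply: pM.
    by rewrite {2}[x]nvar0_mpolyC -mpolyCM mulVf.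
  rewrite /= [f]nvar0_mpolyC mmapC fmorph_eq0; apply: contra_notN pf => /eqP f0.
  by rewrite [f]nvar0_mpolyC f0.
(* [th] substitutes the last variable for ['X] and thus undoes [muni]; the prime ideal is pulled
   back along it. *)
pose th : {rmorphism {poly {mpoly F[n]}} -> {mpoly F[n.+1]}} :=
  horner_eval 'X_ord_max \o map_poly (@mwiden n F).
have thC c : th c%:P = mwiden c.
  by rewrite /= map_polyC /horner_eval hornerC.
have thX : th 'X = 'X_ord_max by rewrite /= map_polyX /horner_eval hornerX.
have muniK : cancel (@muni n F) th.
  move=> u; rewrite muniE rmorph_sum [RHS]mpolyE; apply: eq_bigr => M _.
  rewrite -mul_polyC rmorphM rmorphXn thX thC mwidenZ -scalerAl.
  congr (_ *: _); rewrite mwidenX mpolyXn -mpolyXD; congr 'X_[_].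
  apply/mnmP => i; rewrite mnmDE mulmnE mnm1E.
  have [j ->|->] := unliftP ord_max i; last first.
    by rewrite mnmwiden_ordmax eqxx mul1n.
  have -> : lift ord_max j = widen_ord (leqnSn n) j.
    by apply/val_inj; rewrite /= /bump leqNgt ltn_ord.
  rewrite mnmwiden_widen mnmE -val_eqE /= gtn_eqF ?ltn_ord //.
  by rewrite mul0n addn0.
have [|phi [phij phi0 phif]] := has_zeros_poly IH (prime_ideal_preim th pP) (a := muni f).
  by change (~ p (th (muni f))); rewrite muniK.
exists (phi \o @muni n F); split => [c|x px|//].
  by rewrite /= muniC phij.
by apply: phi0; change (p (th (muni x))); rewrite muniK.
Qed.

(** Zorn's lemma gives an ideal [p] maximal among those containing [K] but no power of [f]. If [x]
    and [y] are outside [p], then [p + (x)] and [p + (y)] both contain a power of [f]; the product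
    of these powers lies in [p + (x * y)], so [x * y] is outside [p]. *)
Lemma prime_avoiding (R : comNzRingType) (K : set R) (f : R) :
    K 0 -> (forall x y, K x -> K y -> K (x + y)) ->
    (forall x y, K y -> K (x * y)) -> (forall e, ~ K (f ^+ e)) ->
  exists p, [/\ prime_ideal p, K `<=` p & ~ p f].
Proof.
move=> K0 KD KM Kf.
pose idl (p : set R) := [/\ p 0, forall x y, p x -> p y -> p (x + y)
  & forall x y, p y -> p (x * y)].
(* [set0] is allowed so that the union of the empty chain qualifies. *)
pose A : set (set R) := [set p | p = set0 \/ [/\ idl p, K `<=` p & forall e, ~ p (f ^+ e)]].
have [Fs FsA FsT|p [Ap pmax]] := @Zorn_bigcup R A.
  have [[X0 [FX0 [x0 X0x0]]]|noX] := pselect (exists X, Fs X /\ X !=set0); last first.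
    left; apply/seteqP; split => // x [X FX Xx]; case: noX.
    by exists X; split => //; exists x.
  have ok X x : Fs X -> X x -> [/\ idl X, K `<=` X & forall e, ~ X (f ^+ e)].
    by move=> FX Xx; case: (FsA X FX) => // X_0; rewrite X_0 in Xx.
  have [[X00 _ _] KX0 _] := ok _ _ FX0 X0x0.
  right; split; first split.
  - by exists X0.
  - move=> x y [X FX Xx] [Y FY Yy].
    have [[_ XD _] _ _] := ok _ _ FX Xx; have [[_ YD _] _ _] := ok _ _ FY Yy.
    have [XY|YX] := FsT _ _ FX FY.
      by exists Y => //; apply: YD => //; apply: XY.
    by exists X => //; apply: XD => //; apply: YX.
  - move=> x y [X FX Xy]; have [[_ _ XM] _ _] := ok _ _ FX Xy.
    by exists X => //; apply: XM.
  - by move=> x Kx; exists X0 => //; apply: KX0.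
  - by move=> e [X FX Xf]; have [_ _ /(_ e)] := ok _ _ FX Xf.
(* The maximal member is not [set0], because [K] itself belongs to [A]. *)
have [[p0 pD pM] Kp pf] : [/\ idl p, K `<=` p & forall e, ~ p (f ^+ e)].
  case: Ap => // p_0; have pK : p `<` K by rewrite p_0; split => // /(_ 0 K0).
  by case: (pmax _ pK); right; split.
have hit a : ~ p a -> exists e u v, p v /\ f ^+ e = u * a + v.
  move=> pa; pose q : set R := [set x | exists u v, p v /\ x = u * a + v].
  have pq : p `<=` q by move=> x px; exists 0, x; rewrite mul0r add0r.
  have qa : q a by exists 1, 0; rewrite mul1r addr0.
  have /not_orP[_ /not_and3P] : ~ A q.
    by apply: pmax; split => // /(_ a qa).
  case=> [[]|[]|/existsNP[e /contrapT [u [v ?]]]]; last by exists e, u, v.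
    split; first exact: pq.
      move=> _ _ [u [v [pv ->]]] [u' [v' [pv' ->]]]; exists (u + u'), (v + v').
      by split; [apply: pD | rewrite mulrDl addrACA].
    move=> x _ [u [v [pv ->]]]; exists (x * u), (x * v).
    by split; [apply: pM | rewrite mulrDr mulrA].
  exact: subset_trans pq.
exists p; split => //; last by have := pf 1%N; rewrite expr1.
split => // x y pxy.
have [?|/hit [e [u [v [pv E1]]]]] := pselect (p x); first by left.
have [?|/hit [e' [u' [v' [pv' E2]]]]] := pselect (p y); first by right.
case: (pf (e + e')%N); rewrite exprD E1 E2 mulrDr.
apply: (pD); last exact: pM.
rewrite mulrDl; apply: pD; last by rewrite mulrC; apply: pM.
by rewrite mulrACA; apply: pM.
Qed.

(** If [f] were outside [K], a prime ideal containing [K] and avoiding [f] would give a homomorphism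
    to [E] killing [K] but not [f]. It is evaluation at the images of the variables, a zero of
    [K]. *)
Lemma nullstellensatz (F : fieldType) (E : closedFieldType)
    (iota : {rmorphism F -> E}) (m : nat) (K : set {mpoly F[m]}) (f : {mpoly F[m]}) :
    is_ideal K -> is_radical K ->
    (forall P, variety iota K P -> evalpt iota P f = 0) -> K f.
Proof.
move=> [K0 KD KM] Krad f0; apply: contrapT => Kf.
have [|p [pP Kp pf]] := prime_avoiding (f := f) K0 KD KM.
  by move=> e /Krad.
have [phi [phij phi0 /eqP]] := has_zeros_mpoly iota pP pf; apply.
pose P := [tuple phi 'X_i | i < m].
have phiE u : phi u = evalpt iota P u.
  rewrite [u in LHS]mpolyE rmorph_sum; apply: eq_bigr => M _.
  rewrite -mul_mpolyC rmorphM phij mpolyXE_id rmorph_prod; congr (_ * _).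
  by apply: eq_bigr => i _; rewrite rmorphXn tnth_mktuple.
by rewrite phiE; apply: f0 => g /Kp /phi0; rewrite phiE.
Qed.

(** * Generalized weighted degree orderings *)

(** If [a] were below [0%MM], repeated doubling of [a] would descend forever. *)
Lemma monomial_order_ge0 (n : nat) (lt : rel 'X_{1..n}) (a : 'X_{1..n}) :
  monomial_order lt -> lt a 0%MM = false.
Proof.
case=> _ lt_tr _ ltD wf_lt; apply/negP.
elim/(well_founded_ind wf_lt): a => a IH a0.
have aa : lt (a + a)%MM a by rewrite -{3}[a]add0m; apply: ltD.
exact: IH (lt_tr _ _ _ aa a0).
Qed.

Section GeneralizedWeightedDegree.
Context (m t : nat) (w : 'I_m -> 'X_{1..t}).
Context (ltN : rel 'X_{1..t}) (ltM : rel 'X_{1..m}).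
Hypotheses (ltN_order : monomial_order ltN) (ltM_order : monomial_order ltM).

Local Notation wt := (weight w).
Local Notation ltw := (gwd_order w ltN ltM).

Lemma weightD (M N : 'X_{1..m}) : wt (M + N)%MM = (wt M + wt N)%MM.
Proof.
apply/mnmP => i; rewrite mnmDE /weight !mnm_sumE -big_split /=.
by apply: eq_bigr => j _; rewrite !mulmnE mnmDE mulnDr.
Qed.

Lemma weight0 : wt 0%MM = 0%MM.
Proof.
apply/mnmP => i; rewrite /weight mnm_sumE mnm0E big1 // => j _.
by rewrite mulmnE mnm0E muln0.
Qed.

Lemma gwd_irr : irreflexive ltw.
Proof.
by move=> M; case: ltN_order ltM_order => [iN _ _ _ _] [iM _ _ _ _];
  rewrite /gwd_order iN iM andbF.
Qed.

Lemma gwd_trans : transitive ltw.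
Proof.
case: ltN_order ltM_order => [_ tN _ _ _] [_ tM _ _ _] M2 M1 M3.
rewrite /gwd_order => /orP[w12|/andP[/eqP -> l12]] /orP[w23|/andP[/eqP <- l23]].
- by rewrite (tN _ _ _ w12 w23).
- by rewrite w12.
- by rewrite w23.
- by rewrite eqxx (tM _ _ _ l12 l23) orbT.
Qed.

Lemma gwd_total (M N : 'X_{1..m}) : M != N -> ltw M N || ltw N M.
Proof.
case: ltN_order ltM_order => [_ _ totN _ _] [_ _ totM _ _] MN.
rewrite /gwd_order; case: eqVneq => [_|/totN /orP[]->]; last 2 first.
- by [].
- by rewrite orbT.
by case/orP: (totM _ _ MN) => ->; rewrite !orbT.
Qed.

Lemma gwd_ge0 (M : 'X_{1..m}) : ltw M 0%MM = false.
Proof.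
by rewrite /gwd_order weight0 (monomial_order_ge0 _ ltN_order)
  (monomial_order_ge0 _ ltM_order) andbF.
Qed.

(** * Leading monomials and strict weight bounds *)

Section LeadingMonomial.
Context (R : nzRingType).
Implicit Types (f : {mpoly R[m]}) (M N : 'X_{1..m}).

Lemma lm_max f : f != 0 ->
  lm ltw f \in msupp f /\ forall N, N \in msupp f -> ltw (lm ltw f) N = false.
Proof.
rewrite -msupp_eq0 /lm; elim: (msupp f) => // M s IH _; rewrite big_cons.
(* A one-term support is treated apart: the starting value [0%MM] need not occur in it but, being
   least, never displaces [M]. *)
have [->|/IH [in_s max_s]] := eqVneq s [::].
  rewrite big_nil gwd_ge0; split; first exact: mem_head.
  by move=> N; rewrite inE => /eqP ->; apply: gwd_irr.
case: ifP => MN; split => [|N]; rewrite inE ?eqxx ?in_s ?orbT //.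
  case/orP => [/eqP ->|/max_s //].
  by apply/negP => /(gwd_trans MN); rewrite gwd_irr.
case/orP => [/eqP ->|Ns]; first exact: gwd_irr.
apply/negP => MN'; move: MN (max_s _ Ns).
set L := \big[_/_]_(_ <- _) _ => ML LN.
have [ML'|/gwd_total] := eqVneq M L; first by rewrite -ML' MN' in LN.
by rewrite ML /= => LM; rewrite (gwd_trans LM MN') in LN.
Qed.

Lemma lm_uniq f M : M \in msupp f ->
  (forall N, N \in msupp f -> ltw M N = false) -> lm ltw f = M.
Proof.
move=> Mf maxM; have f0 : f != 0 by apply: contraTneq Mf => ->; rewrite msupp0.
have [Lf maxL] := lm_max f0; apply/eqP/negPn/negP => /gwd_total.
by rewrite (maxL _ Mf) (maxM _ Lf).
Qed.

(** Error terms are bounded by weight alone, so that the bound survives when a monomial is rewritten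
    into another of the same weight. *)
Definition weight_below (W : 'X_{1..t}) f :=
  forall M, M \in msupp f -> ltN (wt M) W.

Lemma weight_below_trans W W' f :
  ltN W W' -> weight_below W f -> weight_below W' f.
Proof. by case: ltN_order => _ tN _ _ _ WW' Wf M /Wf /tN; apply. Qed.

Lemma weight_below0 W : weight_below W 0.
Proof. by move=> N; rewrite msupp0. Qed.

Lemma weight_belowD W f g :
  weight_below W f -> weight_below W g -> weight_below W (f + g).
Proof. by move=> Wf Wg M /msuppD_le; rewrite mem_cat => /orP[/Wf|/Wg]. Qed.

Lemma weight_belowZ W (c : R) f : weight_below W f -> weight_below W (c *: f).
Proof. by move=> Wf M /msuppZ_le /Wf. Qed.

Lemma weight_belowMX W f M :
  weight_below W f -> weight_below (W + wt M)%MM (f * 'X_[M]).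
Proof.
case: ltN_order => _ _ _ ltD _ Wf N.
rewrite (perm_mem (msuppMX _ _)) => /mapP [N' /Wf WN' ->].
by rewrite weightD addmC; apply: ltD.
Qed.

Lemma lm_weight_below (c : R) M f : c != 0 -> weight_below (wt M) f ->
  c *: 'X_[M] + f != 0 /\ lm ltw (c *: 'X_[M] + f) = M.
Proof.
case: ltN_order => iN tN _ _ _ c0 Mf.
have Min : M \in msupp (c *: 'X_[M] + f).
  rewrite mcoeff_msupp mcoeffD mcoeffZ mcoeffX eqxx mulr1.
  by rewrite (memN_msupp_eq0 (p := f)) ?addr0 //; apply/negP => /Mf; rewrite iN.
split; first by apply: contraTneq Min => ->; rewrite msupp0.
apply: lm_uniq => // N /msuppD_le; rewrite mem_cat => /orP[/msuppZ_le|/Mf WN].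
  by rewrite msuppX inE => /eqP ->; apply: gwd_irr.
apply/negP => /orP[MN|/andP[/eqP MN _]]; last by rewrite MN iN in WN.
by have := tN _ _ _ WN MN; rewrite iN.
Qed.

End LeadingMonomial.
End GeneralizedWeightedDegree.

(** * Independence of products modulo an ideal *)

(** On an infinite set [fset_set] takes the default value [fset0], so the inclusion holds there too
    and the set counted by [sigma] can be enumerated directly. *)
Lemma fset_set_sub (T : choiceType) (A : set T) (x : T) :
  x \in fset_set A -> A x.
Proof.
have [finA|infA] := pselect (finite_set A).
  by rewrite in_fset_set // inE.
by rewrite /fset_set; case: pselect.
Qed.

(** * Normal forms under the order domain conditions *)

Section Footprint.
Context (F : fieldType) (m t : nat) (w : 'I_m -> 'X_{1..t}).
Context (ltN : rel 'X_{1..t}) (ltM : rel 'X_{1..m}).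
Hypotheses (ltN_order : monomial_order ltN) (ltM_order : monomial_order ltM).

Local Notation wt := (weight w).
Local Notation ltw := (gwd_order w ltN ltM).
Local Notation below := (weight_below w ltN).

Lemma footprint_anti (K K' : set {mpoly F[m]}) :
  K `<=` K' -> footprint ltw K' `<=` footprint ltw K.
Proof. by move=> KK' M notK' [f [/KK' Kf f0 fM]]; apply: notK'; exists f. Qed.

Lemma mpoly_split (f : {mpoly F[m]}) (M : 'X_{1..m}) (W : 'X_{1..t}) :
    (forall N, N \in msupp f -> N != M -> ltN (wt N) W) ->
  exists2 r, below W r & f = f@_M *: 'X_[M] + r.
Proof.
move=> hf; exists (f - f@_M *: 'X_[M]); last by rewrite addrC subrK.
move=> N; rewrite mcoeff_msupp mcoeffB mcoeffZ mcoeffX.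
have [<-|MN] := eqVneq M N; first by rewrite mulr1 subrr eqxx.
by rewrite mulr0 subr0 => fN; apply: hf; rewrite ?mcoeff_msupp // eq_sym.
Qed.

Variable I : set {mpoly F[m]}.
Hypothesis I_ideal : is_ideal I.

Let ID f g : I f -> I g -> I (f + g). Proof. by case: I_ideal => _ + _; apply. Qed.
Let IM f g : I g -> I (f * g). Proof. by case: I_ideal => _ _; apply. Qed.
Let IZ c f : I f -> I (c *: f). Proof. by rewrite -mul_mpolyC; apply: IM. Qed.

Hypothesis I_odc : order_domain_conditions w ltN ltM I.

(* Dividing by an element of the Groebner basis replaces the leading monomial by
   the other monomial of highest weight, so the weight does not drop. *)
Lemma monomial_normal_form (N : 'X_{1..m}) :
  exists c M r, [/\ c != 0, footprint ltw I M, wt M = wt N, below (wt N) r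
    & I ('X_[N] - (c *: 'X_[M] + r))].
Proof.
case: I_odc => [[G [GI Gdiv] G2] _].
have [iN tN totN ltND _] := ltN_order; have [iM tM totM ltMD wfM] := ltM_order.
(* The induction is along [ltM]: rewriting preserves the weight, so only the tie-break decreases. *)
elim/(well_founded_ind wfM): N => N IH.
have [Nfp|/contrapT [f [If f0 fN]]] := pselect (footprint ltw I N).
  exists 1, N, 0; split => //; rewrite ?oner_neq0 //; first exact: weight_below0.
  by rewrite scale1r addr0 subrr; case: I_ideal.
have [g gG] := Gdiv f If f0; rewrite {}fN => gN.
have [Ig g0] := GI g gG; have [Lg maxL] := lm_max w ltN_order ltM_order g0.
move: gN Lg maxL; set L := lm ltw g => LN Lg maxL.
have topL N' : N' \in msupp g -> ltN (wt L) (wt N') = false.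
  by move=> /maxL /norP [/negbTE].
have below_top N' : N' \in msupp g -> wt N' != wt L -> ltN (wt N') (wt L).
  by move=> N'g /totN; rewrite topL // orbF.
set H := highest_weight_monomials w ltN g.
have inH N' : (N' \in H) = (N' \in msupp g) && (wt N' == wt L).
  rewrite mem_filter andbC; apply: andb_id2l => N'g; apply/allP/eqP => [top|-> M Mg].
    by apply/eqP/negPn/negP => /(below_top _ N'g); apply/negP/top.
  by rewrite topL.
(* Condition (i): besides the leading monomial [L], exactly one monomial [L2] of [g] reaches the
   highest weight. *)
have [L2 L2L HE] : exists2 L2, L2 != L & H =i [:: L; L2].
  have uH : uniq H by rewrite filter_uniq // msupp_uniq.
  have LH : L \in H by rewrite inH Lg /=.
  have := G2 g gG; rewrite -/H; case: (H) uH LH => [|x [|y []]] //=.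
  rewrite inE andbT => xy; rewrite !inE => /orP[] /eqP -> _.
    by exists y; rewrite // eq_sym.
  by exists x => // z; rewrite !inE orbC.
have /andP[L2g /eqP wL2] : (L2 \in msupp g) && (wt L2 == wt L).
  by rewrite -inH HE !inE eqxx orbT.
have ltL2 : ltM L2 L.
  have := maxL _ L2g; rewrite /gwd_order wL2 eqxx /= => /norP[_ nL].
  by have := totM _ _ L2L; rewrite (negbTE nL) orbF.
have gL : g@_L != 0 by rewrite -mcoeff_msupp.
have gL2 : g@_L2 != 0 by rewrite -mcoeff_msupp.
have [|r rL gE] := @mpoly_split (g - g@_L *: 'X_[L]) L2 (wt L).
  move=> N'; rewrite mcoeff_msupp mcoeffB mcoeffZ mcoeffX => gN' N'L2.
  have N'L : N' != L by apply: contraNneq gN' => ->; rewrite eqxx mulr1 subrr.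
  have N'g : N' \in msupp g.
    by rewrite mcoeff_msupp; move: gN'; rewrite [L == _]eq_sym (negbTE N'L) mulr0 subr0.
  apply: below_top => //; have := inH N'; rewrite HE N'g !inE (negbTE N'L) (negbTE N'L2) /=.
  by move <-.
have {gE} gE : g = g@_L *: 'X_[L] + (g@_L2 *: 'X_[L2] + r).
  move: gE; rewrite mcoeffB mcoeffZ mcoeffX [L == _]eq_sym (negbTE L2L) mulr0 subr0 => <-.
  by rewrite addrC subrK.
pose N' := (N - L)%MM; have NE : N = (L + N')%MM by rewrite addmC submK.
pose N2 := (L2 + N')%MM.
have wN2 : wt N2 = wt N by rewrite NE !weightD wL2.
have [|c [M [r' [c0 Mfp wM r'N Ic]]]] := IH N2.
  by rewrite NE; apply: ltMD.
(* Solving [g = 0] for ['X_[L]] and multiplying by ['X_[N']] turns ['X_[N]] into a multiple of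
   ['X_[N2]] plus terms of lower weight; the induction hypothesis then rewrites ['X_[N2]]. *)
exists (- (g@_L2 / g@_L) * c), M, (- (g@_L2 / g@_L) *: r' - (g@_L)^-1 *: (r * 'X_[N'])).
split => //.
- by rewrite mulf_neq0 // oppr_eq0 mulf_neq0 ?invr_eq0.
- by rewrite wM.
- apply: weight_belowD; first by apply: weight_belowZ; rewrite -wN2.
  by rewrite -scaleNr; apply: weight_belowZ; rewrite NE weightD; apply: weight_belowMX.
have -> : 'X_[N] - (- (g@_L2 / g@_L) * c *: 'X_[M]
      + (- (g@_L2 / g@_L) *: r' - (g@_L)^-1 *: (r * 'X_[N'])))
   = (g@_L)^-1 *: ('X_[N'] * g) + (- (g@_L2 / g@_L)) *: ('X_[N2] - (c *: 'X_[M] + r')).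
  have XN : 'X_[N] = ((g@_L)^-1 * g@_L)%:MP * ('X_[N'] * 'X_[L]) :> {mpoly F[m]}.
    by rewrite mulVf // mpolyC1 mul1r -mpolyXD NE addmC.
  have -> : 'X_[N'] * g = 'X_[N'] * (g@_L *: 'X_[L] + (g@_L2 *: 'X_[L2] + r)) by rewrite -gE.
  rewrite XN [X in _ *: (X - _)]mpolyXD -!mul_mpolyC !(mpolyCM, mpolyCN); ring.
apply: ID; first by apply: IZ; apply: IM.
exact: IZ.
Qed.

(** The normal form of [alpha + M] has its top monomial in the footprint of [I] with the same weight
    as [delta]; condition (ii) makes the two equal. *)
Lemma product_normal_form (f : {mpoly F[m]}) (alpha M delta : 'X_{1..m}) :
    alpha \in msupp f ->
    (forall N, N \in msupp f -> N != alpha -> ltN (wt N) (wt alpha)) ->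
    footprint ltw I delta -> wt delta = (wt alpha + wt M)%MM ->
  exists c r, [/\ c != 0, below (wt delta) r
    & I (f * 'X_[M] - (c *: 'X_[delta] + r))].
Proof.
move=> af amax Idelta wdelta.
have [r0 r0a fE] := mpoly_split amax.
have [c [D [r [c0 ID' wD rD Ic]]]] := monomial_normal_form (alpha + M)%MM.
have wD' : wt (alpha + M)%MM = wt delta by rewrite weightD.
have <- : D = delta by case: I_odc => _; apply=> //; rewrite wD.
exists (f@_alpha * c), (f@_alpha *: r + r0 * 'X_[M]); split.
- by rewrite mulf_neq0 // -mcoeff_msupp.
- apply: weight_belowD; first by apply: weight_belowZ; rewrite wD.
  by rewrite wD weightD; apply: weight_belowMX.
rewrite {1}fE mulrDl -scalerAl -mpolyXD addrA opprD addrACA subrr addr0.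
by rewrite -scalerA -scalerDr -scalerBr; apply: IZ.
Qed.

End Footprint.

(** * Linear independence modulo the larger ideal *)

Section Independence.
Context (F : fieldType) (m t : nat) (w : 'I_m -> 'X_{1..t}).
Context (ltN : rel 'X_{1..t}) (ltM : rel 'X_{1..m}).
Hypotheses (ltN_order : monomial_order ltN) (ltM_order : monomial_order ltM).
Variable K : set {mpoly F[m]}.
Hypothesis K_ideal : is_ideal K.

Local Notation wt := (weight w).
Local Notation ltw := (gwd_order w ltN ltM).
Local Notation below := (weight_below w ltN).

(** In a nontrivial relation, the [delta x] of largest weight with [a x != 0] would be the leading
    monomial of an element of [K], against its lying in the footprint. *)
Lemma footprint_independent (T : finType) (delta : T -> 'X_{1..m}) (c : T -> F)
    (r p : T -> {mpoly F[m]}) (a : T -> F) :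
    injective (wt \o delta) -> (forall x, footprint ltw K (delta x)) ->
    (forall x, c x != 0) -> (forall x, below (wt (delta x)) (r x)) ->
    (forall x, K (p x - (c x *: 'X_[delta x] + r x))) ->
  K (\sum_x a x *: p x) -> forall x, a x = 0.
Proof.
move=> inj_wt fp c0 rx Kp Kap; have [K0 KD KM] := K_ideal.
have KZ b f : K f -> K (b *: f) by rewrite -mul_mpolyC; apply: KM.
have [iN tN totN _ _] := ltN_order.
have inj_delta : injective delta by move=> x y xy; apply: inj_wt; rewrite /= xy.
(* An auxiliary polynomial whose leading monomial singles out the index [x0] of the dominant
   term. *)
pose e := \sum_x a x *: 'X_[delta x].
have e_coef x : e@_(delta x) = a x.
  rewrite /e linear_sum (bigD1 x) //= mcoeffZ mcoeffX eqxx mulr1 big1 ?addr0 // => y yx.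
  by rewrite mcoeffZ mcoeffX (inj_eq inj_delta) (negbTE yx) mulr0.
have [e0 x|e0] := eqVneq e 0; first by rewrite -e_coef e0 mcoeff0.
have [Le Lmax] := lm_max w ltN_order ltM_order e0.
have [x0 x0L] : exists x, delta x = lm ltw e.
  apply: contrapT => noL; move: Le; rewrite mcoeff_msupp linear_sum big1 ?eqxx //= => x _.
  rewrite mcoeffZ mcoeffX; case: eqVneq => [xL|_]; last by rewrite mulr0.
  by case: noL; exists x.
rewrite -x0L in Le Lmax.
have ax0 : a x0 != 0 by rewrite -e_coef -mcoeff_msupp.
have ltx0 x : x != x0 -> a x != 0 -> ltN (wt (delta x)) (wt (delta x0)).
  move=> xx0; rewrite -e_coef -mcoeff_msupp => /Lmax /norP[nx _].
  have : wt (delta x) != wt (delta x0) by rewrite (inj_eq inj_wt).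
  by move=> /totN; rewrite (negbTE nx) orbF.
pose q := \sum_x a x *: (c x *: 'X_[delta x] + r x).
have Kq : K q.
  have -> : q = \sum_x a x *: p x + -1 *: \sum_x a x *: (p x - (c x *: 'X_[delta x] + r x)).
    rewrite scaler_sumr -big_split; apply: eq_bigr => x _ /=.
    by rewrite scaleN1r -scalerBr opprB addrCA subrr addr0.
  apply: (KD) => //; apply: (KZ); elim/big_rec: _ => // x f _ Kf.
  by apply: KD => //; apply: KZ.
suff [q0 qL] : q != 0 /\ lm ltw q = delta x0 by case: (fp x0); exists q.
rewrite /q (bigD1 x0) //= scalerDr scalerA -addrA.
apply: lm_weight_below => //; first by rewrite mulf_neq0.
apply: weight_belowD; first exact: weight_belowZ.
elim/big_rec: _ => [|x f xx0 fx0]; first exact: weight_below0.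
apply: weight_belowD => //.
have [->|ax] := eqVneq (a x) 0; first by rewrite scale0r; apply: weight_below0.
apply: weight_belowZ; apply: weight_belowD; last first.
  by apply: weight_below_trans (rx x) => //; apply: ltx0.
by move=> N /msuppZ_le; rewrite msuppX inE => /eqP ->; apply: ltx0.
Qed.

Lemma sigma_independent (I : set {mpoly F[m]}) (f : {mpoly F[m]}) :
    is_ideal I -> order_domain_conditions w ltN ltM I -> I `<=` K -> f != 0 ->
    (forall M, M \in msupp f -> footprint ltw K M) ->
  exists M : 'I_(sigma w ltw I K (wt (lm ltw f))) -> 'X_{1..m},
    forall a : _ -> F, K (\sum_x a x *: (f * 'X_[M x])) -> forall x, a x = 0.
Proof.
move=> I_ideal I_odc IK f0 ffp; rewrite /sigma.
set A := [set eta | _ /\ _]; set S := fset_set A.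
have [_ _ totN _ _] := ltN_order.
have fp_inj M N : footprint ltw K M -> footprint ltw K N -> wt M = wt N -> M = N.
  by move=> /(footprint_anti IK) ? /(footprint_anti IK) ?; case: I_odc => _; apply.
have [Lf Lmax] := lm_max w ltN_order ltM_order f0.
(* Distinct footprint monomials have distinct weights, so the leading monomial of [f] strictly
   dominates the others by weight, not just by tie-break. *)
have below_lm N : N \in msupp f -> N != lm ltw f -> ltN (wt N) (wt (lm ltw f)).
  move=> Nf NL; have : wt N != wt (lm ltw f).
    by apply: contraNneq NL => /fp_inj -> //; apply: ffp.
  by move=> /totN; case/norP: (Lmax _ Nf) => /negbTE -> _; rewrite orbF.
pose eta (x : 'I_#|`S|) := nth 0%MM (enum_fset S) x.
have eta_inj : injective eta.
  by move=> x y /eqP; rewrite nth_uniq ?fset_uniq // => /eqP/val_inj.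
have Aeta x : A (eta x) by apply: fset_set_sub; apply: mem_nth.
(* Each counted weight yields a pair: a footprint monomial of [K] having this weight, and the
   multiplier [M] that raises [lm ltw f] to it. *)
have /choice [dM dMP] x : exists dM : 'X_{1..m} * 'X_{1..m},
    footprint ltw K dM.1 /\ wt dM.1 = eta x /\ eta x = (wt (lm ltw f) + wt dM.2)%MM.
  by have [[D KD De] [_ [M IM <-] E]] := Aeta x; exists (D, M).
exists (fun x => (dM x).2) => a.
have /choice [cr crP] x : exists cr : F * {mpoly F[m]},
    [/\ cr.1 != 0, below (wt (dM x).1) cr.2
      & K (f * 'X_[(dM x).2] - (cr.1 *: 'X_[(dM x).1] + cr.2))].
  have [Kd [wd ed]] := dMP x.
  have [||c [r [c0 rb Ic]]] := product_normal_form ltN_order ltM_order I_ideal I_odc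
    (M := (dM x).2) (delta := (dM x).1) Lf below_lm.
  - exact: footprint_anti Kd.
  - by rewrite wd.
  by exists (c, r); split => //; apply: IK.
apply: (@footprint_independent _ (fun x => (dM x).1) (fun x => (cr x).1) (fun x => (cr x).2)).
- by move=> x y /=; have [_ [-> _]] := dMP x; have [_ [-> _]] := dMP y => /eta_inj.
- by move=> x; have [] := dMP x.
- by move=> x; have [] := crP x.
- by move=> x; have [] := crP x.
- by move=> x; have [] := crP x.
Qed.

End Independence.

(** * Frobenius and evaluation *)

Section FrobeniusPower.
Context (F : finFieldType) (E : fieldType) (iota : {rmorphism F -> E}).

Lemma exprD_card (l : nat) (x y : E) :
  (x + y) ^+ (#|F| ^ l) = x ^+ (#|F| ^ l) + y ^+ (#|F| ^ l).
Proof.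
have [p p_pr pF] := finPcharP F.
rewrite exprDn_pchar //.
have -> : #|F| = (p ^ logn p #|F|)%N.
  by rewrite (card_pprimeChar pF) pfactorK.
have pE : p \in GRing.pchar E by rewrite (fmorph_pchar iota).
by rewrite -expnM (eq_pnat _ (pcharf_eq pE)) pnatX pnat_id.
Qed.

Lemma expr_card_iota (l : nat) (a : F) : iota a ^+ (#|F| ^ l) = iota a.
Proof.
by elim: l => [|l IH]; rewrite ?expr1 // expnSr exprM IH -rmorphXn expf_card.
Qed.

(** [X^q - X] splits over [F] as the product of all [X - a], so its roots in [E] all come from
    [F]. *)
Lemma expr_card_fixed (x : E) : x ^+ #|F| = x -> exists a, x = iota a.
Proof.
move=> xq; have : root (\prod_(a : F) ('X - (iota a)%:P)) x.
  rewrite -(eq_bigr _ (fun a _ => map_polyXsubC iota a)) -rmorph_prod -finField_genPoly.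
  by rewrite rmorphB /= map_polyXn map_polyX rootE !hornerE xq subrr.
rewrite -(big_map iota xpredT (fun y => 'X - y%:P)) root_prod_XsubC.
by move=> /mapP [a _ ->]; exists a.
Qed.

(** Galois descent by shrinking supports. A kernel vector scaled to have a coordinate 1 is compared
    with its Frobenius image, again in the kernel since Frobenius permutes the columns of [A]:
    either they agree and the entries lie in [F], or their difference has smaller support. *)
Lemma frobenius_descent (s h : nat) (A : 'M[E]_(s, h)) (tau : 'I_h -> 'I_h)
    (v : 'rV[E]_s) :
    injective tau -> (forall j i, A j i ^+ #|F| = A j (tau i)) ->
    v != 0 -> v *m A = 0 ->
  exists2 a : 'I_s -> F, exists j, a j != 0 & forall i, \sum_j iota (a j) * A j i = 0.
Proof.
move=> tau_inj Atau.
have q0 : (#|F| == 0)%N = false by rewrite (cardD1 (0 : F)).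
have [N] := ubnP #|[pred j | v 0 j != 0]|; elim: N v => // N IH v.
rewrite ltnS => leN v0 vA.
have /rV0Pn [j0 vj0] := v0.
pose u := (v 0 j0)^-1 *: v.
have uA i : \sum_j u 0 j * A j i = 0.
  have : (u *m A) 0 i = 0 by rewrite -scalemxAl vA scaler0 mxE.
  by rewrite mxE.
pose u' : 'rV[E]_s := \row_j (u 0 j ^+ #|F| - u 0 j).
have u'A : u' *m A = 0.
  apply/rowP => i; rewrite !mxE.
  rewrite (eq_bigr (fun j => u 0 j ^+ #|F| * A j i - u 0 j * A j i)); last first.
    by move=> j _; rewrite mxE mulrBl.
  rewrite sumrB uA subr0; have [tau' _ tauK] := injF_bij tau_inj; rewrite -(tauK i).
  (* Column [i] is the Frobenius image of column [tau' i], so the sum is the [q]-th power of a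
     vanishing one. *)
  transitivity ((\sum_j u 0 j * A j (tau' i)) ^+ (#|F| ^ 1)); last first.
    by rewrite uA expn1 expr0n q0.
  rewrite (big_morph (fun x => x ^+ (#|F| ^ 1)) (exprD_card 1) (id1 := 0)).
    by apply: eq_bigr => j _; rewrite expn1 exprMn Atau.
  by rewrite expn1 expr0n q0.
have [u'0|u'0] := eqVneq u' 0.
  have /choice [a aE] j : exists a, u 0 j = iota a.
    apply: expr_card_fixed; apply/eqP; rewrite -subr_eq0.
    by move/rowP: u'0 => /(_ j); rewrite !mxE => ->.
  exists a; last by move=> i; rewrite -[RHS](uA i); apply: eq_bigr => j _; rewrite aE.
  exists j0; rewrite -(fmorph_eq0 iota) -aE mxE mulVf ?oner_neq0 //.
apply: IH u'0 u'A; apply: leq_trans leN.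
apply: proper_card; apply/properP; split.
  apply/fintype.subsetP => j; rewrite !inE; apply: contraNneq => vj.
  by rewrite !mxE vj mulr0 expr0n subr0 q0.
by exists j0; rewrite !inE // !mxE mulVf // expr1n subrr eqxx.
Qed.

End FrobeniusPower.

(** * Evaluation at points and the number of nonzero values *)

Section Evaluation.
Context (F : finFieldType) (E : closedFieldType) (iota : {rmorphism F -> E}).
Context (m : nat).

Lemma expr_card_inj (l : nat) : injective (fun x : E => x ^+ (#|F| ^ l)).
Proof.
move=> x y /= xy; have := exprD_card iota l (x - y) y.
rewrite subrK xy => /eqP; rewrite -subr_eq subrr eq_sym expf_eq0 => /andP[_].
by rewrite subr_eq0 => /eqP.
Qed.

(** Frobenius fixes the coefficients, which come from [F], and so acts on the point alone. *)
Lemma evalpt_card (l : nat) (P : m.-tuple E) (f : {mpoly F[m]}) :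
  evalpt iota P f ^+ (#|F| ^ l) =
  evalpt iota (map_tuple (fun x => x ^+ (#|F| ^ l)) P) f.
Proof.
rewrite /evalpt /mmap (big_morph _ (exprD_card iota l) (id1 := 0)); last first.
  by rewrite expr0n expn_eq0 (cardD1 (0 : F)).
apply: eq_bigr => M _; rewrite exprMn expr_card_iota /mmap1 -prodrXl.
by congr (_ * _); apply: eq_bigr => i _; rewrite tnth_map exprAC.
Qed.

Lemma evalptM (P : m.-tuple E) : {morph evalpt iota P : f g / f * g}.
Proof. by move=> f g; rewrite /evalpt rmorphM. Qed.

Lemma evalptB (P : m.-tuple E) : {morph evalpt iota P : f g / f - g}.
Proof. by move=> f g; rewrite /evalpt rmorphB. Qed.

Lemma evalptZ (P : m.-tuple E) (c : F) (f : {mpoly F[m]}) :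
  evalpt iota P (c *: f) = iota c * evalpt iota P f.
Proof. exact: mmapZ. Qed.

Lemma sigma_le_nonzeros (t h : nat) (w : 'I_m -> 'X_{1..t}) (ltN : rel 'X_{1..t})
    (ltM : rel 'X_{1..m}) (I K : set {mpoly F[m]}) (P : 'I_h -> m.-tuple E)
    (f : {mpoly F[m]}) :
    let ltw := gwd_order w ltN ltM in
    monomial_order ltN -> monomial_order ltM ->
    is_ideal I -> order_domain_conditions w ltN ltM I ->
    is_ideal K -> is_radical K -> I `<=` K ->
    injective P -> range P = variety iota K ->
    f != 0 -> (forall M, M \in msupp f -> footprint ltw K M) ->
  (sigma w ltw I K (weight w (lm ltw f)) <= #|[pred i | evalpt iota (P i) f != 0%R]|)%N.
Proof.
move=> ltw ltN_order ltM_order I_ideal I_odc K_ideal K_rad IK P_inj PK f0 ffp.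
have [M indep] := sigma_independent ltN_order ltM_order K_ideal I_ideal I_odc IK f0 ffp.
set s := sigma _ _ _ _ _; rewrite leqNgt; apply/negP => lt_s.
have KP i g : K g -> evalpt iota (P i) g = 0.
  by have : range P (P i) by []; rewrite PK; apply.
pose A : 'M[E]_(s, h) := \matrix_(j, i) evalpt iota (P i) (f * 'X_[M j]).
(* Since [K] is defined over [F], Frobenius maps its zeros to zeros and induces a map [tau] on the
   indices. *)
have /choice [tau tauE] i : exists i', P i' = map_tuple (fun x => x ^+ (#|F| ^ 1)) (P i).
  suff : range P (map_tuple (fun x => x ^+ (#|F| ^ 1)) (P i)) by case=> i' _ <-; exists i'.
  by rewrite PK => g Kg; rewrite -evalpt_card KP // expr0n expn_eq0 (cardD1 (0 : F)).
have tau_inj : injective tau.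
  move=> i i' /(congr1 P); rewrite !tauE => /(congr1 (@tval _ _)) /=.
  by move=> /(inj_map (@expr_card_inj 1)) /val_inj /P_inj.
have Atau j i : A j i ^+ #|F| = A j (tau i).
  by rewrite !mxE tauE -evalpt_card expn1.
pose S := [pred i | evalpt iota (P i) f != 0].
(* Only the columns where [f] is nonzero are kept. There are fewer of them than rows, which forces a
   left kernel vector; it also kills [A], whose other columns are zero. *)
pose B : 'M[E]_(s, #|S|) := \matrix_(j, i) A j (enum_val i).
have : kermx B != 0.
  rewrite kermx_eq0 -row_leq_rank -ltnNge; apply: leq_ltn_trans lt_s.
  exact: rank_leq_col.
move=> /rowV0Pn [v /sub_kermxP vB v0].
have vA : v *m A = 0.
  apply/rowP => i; rewrite [RHS]mxE; have [Si|] := boolP (i \in S).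
    have /rowP/(_ (enum_rank_in Si i)) := vB; rewrite !mxE => vBi; rewrite -[RHS]vBi.
    by apply: eq_bigr => j _; rewrite [B _ _]mxE enum_rankK_in.
  rewrite inE negbK => /eqP fi; rewrite mxE big1 // => j _.
  by rewrite mxE evalptM fi mul0r mulr0.
have [a [j aj] aA] := frobenius_descent iota tau_inj Atau v0 vA.
move: aj; rewrite (indep a) ?eqxx //.
apply: (nullstellensatz (iota := iota) K_ideal K_rad); rewrite -PK => _ [i _ <-].
rewrite /evalpt rmorph_sum -[RHS](aA i); apply: eq_bigr => x _.
by rewrite mxE -evalptZ.
Qed.

End Evaluation.

(** * Minima of sets of numbers and Hamming distance of concatenated words *)

Lemma natmin_le (A : set nat) (k : nat) : A k -> (natmin A <= k)%N.
Proof.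
move=> Ak; have /classical_minn [x [Ax minx]] : A !=set0 by exists k.
rewrite /natmin; case: xgetP => [y _ [Ay miny]|/(_ x)]; first exact: miny.
by case; split.
Qed.

Lemma natmin_in (A : set nat) : A !=set0 -> A (natmin A).
Proof.
move=> /classical_minn [x minx]; rewrite /natmin.
by case: xgetP => [y _ []|/(_ x)].
Qed.

Lemma natmin_set0 (A : set nat) : ~ (A !=set0) -> natmin A = 0%N.
Proof.
move=> A0; rewrite /natmin; case: xgetP => // y _ [Ay _].
by case: A0; exists y.
Qed.

Lemma hdist_mxrow (T : eqType) (h : nat) (n : 'I_h -> nat)
    (u v : forall i, 'rV[T]_(n i)) :
  hdist (\mxrow_i u i) (\mxrow_i v i) = (\sum_i hdist (u i) (v i))%N.
Proof.
rewrite /hdist -sum1_card big_mkcond (reindex tagnat.rank); last first.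
  exact: onW_bij tagnat.rank_bij.
rewrite [RHS](eq_bigr (fun i => \sum_(j < n i | u i ord0 j != v i ord0 j) 1)%N); last first.
  by move=> i _; rewrite sum1_card.
under [RHS]eq_bigr do rewrite big_mkcond.
rewrite sig_big_dep /=; apply: eq_big => // -[i j] _.
have mxrowE (x : forall i, 'rV[T]_(n i)) :
    (\mxrow_i x i) ord0 (tagnat.Rank i j) = x i ord0 j.
  by rewrite -[in RHS](mxrowK x i) [RHS]mxE.
by rewrite !inE !mxrowE.
Qed.

(** * The minimum distance bound *)

Lemma ideal_add_ideal (R : comNzRingType) (m : nat) (I J : set {mpoly R[m]}) :
  is_ideal I -> is_ideal J -> is_ideal (ideal_add I J).
Proof.
move=> [I0 ID IM] [J0 JD JM]; split.
- by exists 0, 0; rewrite addr0.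
- move=> _ _ [a [b [Ia Jb ->]]] [c [d [Ic Jd ->]]]; exists (a + c), (b + d).
  by split; [apply: ID | apply: JD | rewrite addrACA].
- move=> f _ [a [b [Ia Jb ->]]]; exists (f * a), (f * b).
  by split; [apply: IM | apply: JM | rewrite mulrDr].
Qed.

Lemma ideal_addl (R : comNzRingType) (m : nat) (I J : set {mpoly R[m]}) :
  is_ideal J -> I `<=` ideal_add I J.
Proof. by move=> [J0 _ _] f If; exists f, 0; rewrite addr0. Qed.

(** * Leading monomials in the span of a well-behaving basis *)

Section WellBehavingBasis.
Context (F : fieldType) (m t : nat) (w : 'I_m -> 'X_{1..t}).
Context (ltN : rel 'X_{1..t}) (ltM : rel 'X_{1..m}).
Hypotheses (ltN_order : monomial_order ltN) (ltM_order : monomial_order ltM).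
Context (K L : set {mpoly F[m]}) (k : nat) (b : 'I_k -> {mpoly F[m]}).

Local Notation ltw := (gwd_order w ltN ltM).

Hypotheses (K_ideal : is_ideal K) (b_basis : well_behaving_basis ltw K L b).

Lemma basis_notin i : ~ K (b i).
Proof.
case: b_basis => free _ _ _ Kb.
have /free/(_ i)/eqP : K (\sum_j (j == i)%:R *: b j).
  rewrite (bigD1 i) //= eqxx scale1r big1 ?addr0 // => j /negbTE ->.
  by rewrite scale0r.
by rewrite eqxx oner_eq0.
Qed.

Lemma basis_neq0 i : b i != 0.
Proof. by apply/eqP => bi; apply: (@basis_notin i); rewrite bi; case: K_ideal. Qed.

Lemma combination_footprint (c : 'I_k -> F) (M : 'X_{1..m}) :
  M \in msupp (\sum_i c i *: b i) -> footprint ltw K M.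
Proof.
case: b_basis => _ _ fp _ /msupp_sum_le /flattenP [s /mapP [i _ ->] /msuppZ_le].
exact: fp.
Qed.

(** The leading monomials of the [b i] increase strictly, so that of the last basis element with
    nonzero coefficient cannot cancel. *)
Lemma combination_lm (c : 'I_k -> F) (i0 : 'I_k) : c i0 != 0 ->
  let f := \sum_i c i *: b i in f != 0 /\ square ltw b (lm ltw f).
Proof.
case: b_basis => _ _ _ b_incr ci0 f.
have [i ci imax] := @arg_maxnP _ i0 (fun i => c i != 0) (fun i => i : nat) ci0.
have lt_i j : c j != 0 -> j != i -> ltw (lm ltw (b j)) (lm ltw (b i)).
  move=> cj ji; apply: b_incr; rewrite ltn_neqAle -val_eqE in ji *.
  by rewrite ji; apply: imax.
have bmax j := lm_max w ltN_order ltM_order (basis_neq0 j).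
have [bi _] := bmax i.
have fi : lm ltw (b i) \in msupp f.
  rewrite mcoeff_msupp linear_sum (bigD1 i) //= mcoeffZ big1 ?addr0; last first.
    move=> j ji; have [->|cj] := eqVneq (c j) 0; first by rewrite scale0r mcoeff0.
    rewrite mcoeffZ memN_msupp_eq0 ?mulr0 //; apply/negP.
    by have [_ /[apply]] := bmax j; rewrite lt_i.
  by rewrite mulf_neq0 // -mcoeff_msupp.
split; first by apply: contraTneq fi => ->; rewrite msupp0.
exists i => //; apply/esym; apply: lm_uniq => // N.
move=> /msupp_sum_le /flattenP [s /mapP [j _ ->]].
have [->|cj] := eqVneq (c j) 0; first by rewrite scale0r msupp0.
move=> /msuppZ_le Nj; have [_ /(_ _ Nj)] := bmax j.
have [-> //|/(lt_i _ cj) ji] := eqVneq j i.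
by apply: contraFF => iN; apply: gwd_trans iN.
Qed.

End WellBehavingBasis.

Theorem theorem3p2
  (F : finFieldType) (Fbar : closedFieldType) (iota : {rmorphism F -> Fbar})
  (Fbar_alg : integralRange iota)
  (m t : nat) (w : 'I_m -> 'X_{1..t})
  (ltN : rel 'X_{1..t}) (ltM : rel 'X_{1..m})
  (w_neq0 : forall i, w i != 0%MM)
  (ltN_order : monomial_order ltN) (ltM_order : monomial_order ltM)
  (I : set {mpoly F[m]}) (I_ideal : is_ideal I)
  (I_odc : order_domain_conditions w ltN ltM I)
  (h : nat) (P : 'I_h -> m.-tuple Fbar) (P_inj : injective P)
  (P_sub : range P `<=` variety iota I)
  (r : 'I_h -> nat) (P_deg : forall i, pt_degree F (P i) = r i)
  (J : set {mpoly F[m]}) (J_ideal : is_ideal J)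
  (P_variety : range P = variety iota (ideal_add I J))
  (IP_radical : is_radical (ideal_add I J))
  (k : nat) (L : set {mpoly F[m]}) (b : 'I_k -> {mpoly F[m]})
  (b_basis : well_behaving_basis (gwd_order w ltN ltM) (ideal_add I J) L b)
  (n d : 'I_h -> nat) (C : forall i, {vspace 'rV[F]_(n i)})
  (C_params : forall i, linear_code_params (C i) (r i) (d i))
  (pi : forall i, Fbar -> 'rV[F]_(n i))
  (pi_iso : forall i, linear_iso_onto iota (r i) (C i) (pi i)) :
  let ltw := gwd_order w ltN ltM in
  let delta :=
    natmin [set sigma w ltw I (ideal_add I J) (weight w alpha)
           | alpha in square ltw b] in
  let dhat := natmin (range d) in
  (delta * dhat <= mindist (ext_affine_variety_code iota P pi L))%N.
Proof.
cbv zeta; have K_ideal := ideal_add_ideal I_ideal J_ideal.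
set K := ideal_add I J in P_variety IP_radical b_basis K_ideal *.
set ltw := gwd_order w ltN ltM in b_basis *.
set delta := natmin [set _ | _ in square _ _]; set dhat := natmin (range d).
have IK : I `<=` K by apply: ideal_addl.
have [K0 KD KM] := K_ideal; have [_ LE _ _] := b_basis.
have KP i g : K g -> evalpt iota (P i) g = 0.
  by have : range P (P i) by []; rewrite P_variety; apply.
(* If no degree existed, [natmin] would return 0, and [finsubfield F 0] is all of [Fbar] because
   [x ^+ 1 = x]; the claim holds in both cases. *)
have P_sub_r i j : finsubfield F (r i) (tnth (P i) j).
  rewrite -P_deg /pt_degree; set A := [set l | _].
  have [/natmin_in [_] //|/natmin_set0 ->] := pselect (A !=set0).
  exact: expr1.
have ev_sub i f : finsubfield F (r i) (evalpt iota (P i) f).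
  rewrite /finsubfield /= evalpt_card; congr (evalpt _ _ _).
  by apply: eq_from_tnth => j; rewrite tnth_map; apply: P_sub_r.
have pi_inj i f g : pi i (evalpt iota (P i) f) = pi i (evalpt iota (P i) g) ->
    evalpt iota (P i) f = evalpt iota (P i) g.
  have [_ [_ inj_pi _]] := pi_iso i.
  by apply: inj_pi; rewrite inE; apply: ev_sub.
have pi_C i f : pi i (evalpt iota (P i) f) \in C i.
  by have [_ [sub_C _ _]] := pi_iso i; apply: sub_C; apply: ev_sub.
rewrite /mindist; set D := [set _ | _].
(* Without two distinct codewords [mindist] is 0 by default, so [delta] must vanish. Indeed [k = 0]:
   any [b i] would encode to a word other than that of 0, by the Nullstellensatz and injectivity of
   the [pi i]. *)
have [D_neq0|/[dup] D0 /natmin_set0 ->] := pselect (D !=set0); last first.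
  suff -> : delta = 0%N by [].
  apply: natmin_set0 => -[_ [_ [i _ _] _]]; apply: D0.
  have Lb : L (b i).
    apply/LE; exists (fun j => (j == i)%:R).
    rewrite (bigD1 i) //= eqxx scale1r big1 ?addr0 ?subrr // => j /negbTE ->.
    by rewrite scale0r.
  have L0 : L 0.
    by apply/LE; exists (fun=> 0); rewrite big1 ?subrr // => j _; rewrite scale0r.
  exists (hdist (ext_ev iota P pi (b i)) (ext_ev iota P pi 0)).
  exists (ext_ev iota P pi (b i)), (ext_ev iota P pi 0).
  split=> //; [by exists (b i) | by exists 0 |].
  apply/eqP; rewrite /ext_ev => /eq_mxrowP eq_ev; case: (basis_notin b_basis (i := i)).
  apply: (nullstellensatz (iota := iota) K_ideal IP_radical); rewrite -P_variety => _ [j _ <-].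
  by rewrite (pi_inj _ _ _ (eq_ev j)) KP.
have [_ [_ [[f1 Lf1 <-] [f2 Lf2 <-] neq ->]]] := natmin_in D_neq0.
have /LE [c1 Kc1] := Lf1; have /LE [c2 Kc2] := Lf2.
(* The representative of [f1 - f2] modulo [K] supported in the footprint; it has the same values at
   the points. *)
pose f := \sum_i (c1 i - c2 i) *: b i.
have fE : f1 - f2 - f = (f1 - \sum_i c1 i *: b i) + -1 * (f2 - \sum_i c2 i *: b i).
  rewrite /f (eq_bigr (fun i => c1 i *: b i - c2 i *: b i)); last first.
    by move=> i _; rewrite scalerBl.
  by rewrite sumrB; ring.
have ev_f i : evalpt iota (P i) f = evalpt iota (P i) f1 - evalpt iota (P i) f2.
  have /(KP i) : K (f1 - f2 - f) by rewrite fE; apply: KD => //; apply: KM.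
  by rewrite !evalptB => /eqP; rewrite subr_eq0 => /eqP.
have [i0 ci0] : exists i, c1 i - c2 i != 0.
  apply: contrapT => /forallNP c12; case/eqP: neq; apply: eq_mxrow => i.
  congr (pi i _); apply/eqP; rewrite -subr_eq0 -ev_f KP // /f big1 // => j _.
  by have /negP := c12 j; rewrite negbK => /eqP ->; rewrite scale0r.
have [f0 sq_f] := combination_lm ltN_order ltM_order K_ideal b_basis
  (c := fun i => c1 i - c2 i) ci0.
have delta_le : (delta <= #|[pred i | evalpt iota (P i) f != 0%R]|)%N.
  apply: leq_trans (sigma_le_nonzeros ltN_order ltM_order I_ideal I_odc K_ideal IP_radical
    IK P_inj P_variety f0 (combination_footprint b_basis (c := _))).
  by apply: natmin_le; exists (lm ltw f).
rewrite hdist_mxrow; apply: leq_trans (leq_mul delta_le (leqnn _)) _.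
(* The product becomes a sum over blocks: where [f] is nonzero, the two blocks are distinct words of
   [C i] by injectivity of [pi i], hence at distance at least [d i]. *)
rewrite -sum_nat_const big_mkcond; apply: leq_sum => i _.
case: ifP => //; rewrite inE ev_f subr_eq0 => neq_i.
apply: (@leq_trans (d i)); first by apply: natmin_le; exists i.
have [_ <-] := C_params i; apply: natmin_le.
exists (pi i (evalpt iota (P i) f1)), (pi i (evalpt iota (P i) f2)).
split => //; try exact: pi_C.
by apply: contra_neq neq_i => /pi_inj.
Qed.
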